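(* Let $G$ be a finite group with identity element $e$, and let $\{e\} = G_0 < G_1 < \dots < G_n = G$ $(n \geq 0)$ be a chain of subgroups of $G$. Let $|G| = a_1 a_2\cdots a_k$ be a factorization of the order of $G$ with $a_1,\dots,a_k$ positive integers. Suppose there exist subsets $s_1,\dots,s_k$ of $\{1,\dots,n\}$ with $s_i\cap s_j=\emptyset$ for $i\neq j$ and $\bigcup_{i\in\{1,\dots,k\}} s_i = \{1,\dots,n\}$ such that: (i) for each $j\in\{1,\dots,n\}$, if $j\in s_t$, then $s_a\cap\{1,\dots,j\}=\emptyset$ holds either for all $a\in\{1,\dots,k\}$ with $a<t$, or for all $a\in\{1,\dots,k\}$ with $a>t$; and (ii) for each $t\in\{1,\dots,k\}$, $\prod_{i\in s_t}|G_i:G_{i-1}| = a_t$. Then there exist subsets $A_1,\dots,A_k\subseteq G$ of cardinalities $|A_i| = a_i$ for all $i$ such that $G = A_1\cdots A_k$.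
   Context: For subsets $A_1,\dots,A_k$ of a group $G$, $A_1\cdots A_k = \{x_1\cdots x_k : x_i\in A_i\}$. $|G_i:G_{i-1}|$ denotes the index of $G_{i-1}$ in $G_i$. The empty product equals $1$. The sets $s_i$ may be empty. *)

(* Defs.v *)
From mathcomp Require Import all_boot all_fingroup.

Set Implicit Arguments.
Unset Strict Implicit.
Unset Printing Implicit Defensive.

(* The index set {1, ..., j} inside 'I_n.+1 = {0, ..., n}. *)
Definition upto (n : nat) (j : 'I_n.+1) : {set 'I_n.+1} :=
  [set i : 'I_n.+1 | 0 < i <= j].

(* Main.v *)
Require Import Defs.
From mathcomp Require Import all_boot all_fingroup.

Set Implicit Arguments.
Unset Strict Implicit.
Unset Printing Implicit Defensive.

(* Build the factorization of G_m by induction on m, keeping A_u = {e} as long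
   as s_u does not meet {1, ..., m}. If m+1 lies in s_t, then by (i) all factors
   on one side of A_t are trivial, so a transversal of G_m in G_(m+1) multiplied
   onto G_m = A_1 ... A_k from that side can be absorbed into A_t. *)

(** [T] picks one representative from each right coset of [K] in [L]. The count is stated for any
    subset [A] of [K] because it will be applied to a single factor of [K], or to the inverse of
    one. *)
Lemma rcoset_transversal_exists (gT : finGroupType) (K L : {group gT}) :
  K \subset L ->
  exists T : {set gT}, (K * T)%g = L /\
    forall A : {set gT}, A \subset K -> #|(A * T)%g| = #|A| * #|L : K|%g.
Proof.
move=> sKL; pose T := [set repr X | X in rcosets K L].
have repr_cosetE X : X \in rcosets K L -> (K :* repr X)%g = X.
  by case/rcosetsP=> x _ ->; exact/rcoset_eqP/mem_repr_rcoset.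
exists T; split=> [|A sAK].
  apply/setP=> x; apply/mulsgP/idP=> [[y _ yK /imsetP[_ /rcosetsP[z zL ->] ->] ->]|xL].
    have /rcosetP[w wK ->] := mem_repr_rcoset K z.
    by rewrite !groupM // (subsetP sKL).
  have XL : (K :* x)%g \in rcosets K L by apply/rcosetsP; exists x.
  have : x \in (K :* repr (K :* x))%g by rewrite repr_cosetE ?rcoset_refl.
  case/rcosetP=> y yK xE; exists y (repr (K :* x)%g) => //.
  exact: imset_f.
have -> : #|L : K|%g = #|T|.
  rewrite card_in_imset // => X Y XL YL eqXY.
  by rewrite -(repr_cosetE X) // eqXY repr_cosetE.
rewrite -cardsX [(A * T)%g]curry_imset2X card_in_imset //.
move=> [y x] [z w] /setXP[/= yA xT] /setXP[/= zA wT] /= eqM.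
(* As [A] lies in [K], a product [y * x] lies in the coset of [x]. Equal products thus share their
   coset, hence its representative, and cancellation gives [y = z]. *)
suff eqxw : x = w by move: eqM; rewrite eqxw => /mulIg->.
case/imsetP: xT eqM => X XL -> eqM; case/imsetP: wT eqM => Y YL -> eqM.
congr repr; rewrite -(repr_cosetE X) // -(repr_cosetE Y) //.
have cosetE u v : u \in A -> (K :* (u * v))%g = (K :* v)%g.
  by move=> uA; rewrite rcosetM rcoset_id ?(subsetP sAK).
by rewrite -(cosetE y) // eqM cosetE.
Qed.

(** The product is noncommutative, so the factor at [t] must be isolated in place: the enumeration
    of ['I_k] is increasing and is cut at [t]. The lists [r1] and [r2] do not depend on [F], so the
    same cut serves both the old and the modified family. *)
Lemma prod_ord_split (M : monoidType) (k : nat) (t : 'I_k) :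
  exists r1 r2 : seq 'I_k,
    [/\ all (fun u : 'I_k => u < t) r1, all (fun u : 'I_k => t < u) r2
      & forall F : 'I_k -> M, (\prod_(u < k) F u =
          (\prod_(u <- r1) F u) * (F t * \prod_(u <- r2) F u))%g].
Proof.
have : pairwise (fun u v : 'I_k => u < v) (index_enum 'I_k).
  rewrite [index_enum _]unlock -enumT -(pairwise_map val ltn) val_enum_ord.
  by rewrite -(sorted_pairwise ltn_trans) iota_ltn_sorted.
have tE := mem_index_enum t.
case/splitPr Er : {1 2}(index_enum 'I_k) / tE => [r1 r2].
rewrite pairwise_cat /= => /and3P[/allrelP lt12 _ /andP[lt2 _]].
exists r1, r2; split=> // [|F]; last by rewrite big_cat big_cons.
by apply/allP=> u ur1; rewrite lt12 ?mem_head.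
Qed.

Lemma extend_factorization (gT : finGroupType) (K L : {group gT}) (k : nat)
    (A : 'I_k -> {set gT}) (t : 'I_k) :
    K \subset L -> A t \subset K -> (\prod_(u < k) A u)%g = K ->
    (forall u : 'I_k, u < t -> A u = 1%g) \/
    (forall u : 'I_k, t < u -> A u = 1%g) ->
  exists B : {set gT},
    [/\ B \subset L, #|B| = #|A t| * #|L : K|%g
      & (\prod_(u < k) (if u == t then B else A u))%g = L].
Proof.
move=> sKL sAK prodA triv.
have [T [KT cardT]] := rcoset_transversal_exists sKL.
have sTL : T \subset L by rewrite -KT mulG_subr.
have sAL := subset_trans sAK sKL.
have [r1 [r2 [lt1 lt2 prodE]]] := prod_ord_split {set gT} t.
have prodB B : (\prod_(u < k) (if u == t then B else A u) =
    (\prod_(u <- r1) A u) * (B * \prod_(u <- r2) A u))%g.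
  rewrite prodE eqxx; congr (_ * (_ * _))%g.
    rewrite big_seq [RHS]big_seq; apply: eq_bigr => u /(allP lt1).
    by case: eqP => // ->; rewrite ltnn.
  rewrite big_seq [RHS]big_seq; apply: eq_bigr => u /(allP lt2).
  by case: eqP => // ->; rewrite ltnn.
move: prodA; rewrite prodE; case: triv => triv.
  rewrite big_seq big1 ?mul1g => [prodA|u /(allP lt1)]; last exact: triv.
  (* [T] multiplies [K] from the right. Inverting [K * T = L] gives [T^-1 * K = L], and the
     cardinality follows by counting [(A t)^-1 * T]. *)
  exists (T^-1 * A t)%g; split.
  - by rewrite mul_subG // inv_subG.
  - by rewrite -card_invg invMg invgK cardT ?inv_subG // card_invg.
  rewrite prodB big_seq big1 => [|u /(allP lt1)]; last exact: triv.
  by rewrite mul1g -mulgA prodA -[K : {set gT}]invGid -invMg KT invGid.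
have r2E : (\prod_(u <- r2) A u)%g = 1%g.
  by rewrite big_seq big1 // => u /(allP lt2); exact: triv.
rewrite r2E mulg1 => prodA; exists (A t * T)%g; split.
- exact: mul_subG.
- exact: cardT.
by rewrite prodB r2E mulg1 mulgA prodA.
Qed.

(* H i plays the role of G_i; its values beyond n are irrelevant. *)
Theorem theorem3p1 (gT : finGroupType) (G : {group gT})
    (n : nat) (H : nat -> {group gT})
    (H0 : H 0 :=: 1%g) (Hn : H n :=: G)
    (Hlt : forall i : nat, i < n -> H i \proper H i.+1)
    (k : nat) (a : 'I_k -> nat)
    (a_gt0 : forall t : 'I_k, 0 < a t)
    (cardG : #|G| = \prod_(t < k) a t)
    (s : 'I_k -> {set 'I_n.+1})
    (s_disj : forall t u : 'I_k, t != u -> s t :&: s u = set0)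
    (s_cover : \bigcup_(t < k) s t = upto ord_max)
    (s_order : forall (j : 'I_n.+1) (t : 'I_k), j \in s t ->
       (forall u : 'I_k, u < t -> s u :&: upto j = set0) \/
       (forall u : 'I_k, t < u -> s u :&: upto j = set0))
    (s_index : forall t : 'I_k, \prod_(i in s t) #|H i : H i.-1|%g = a t) :
  exists A : 'I_k -> {set gT},
    [/\ forall t : 'I_k, A t \subset G,
        forall t : 'I_k, #|A t| = a t
      & G :=: (\prod_(t < k) A t)%g].
Proof.
(* The ordinal [0] lies in no [s t], so [i.-1] is always a true predecessor, and the products of
   indices are empty at [m = 0]. *)
have s_pos t i : i \in s t -> 0 < i.
  move=> ist; have : i \in upto (@ord_max n) by rewrite -s_cover; apply/bigcupP; exists t.
  by rewrite inE => /andP[].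
suff chain m : m <= n -> exists A : 'I_k -> {set gT},
    [/\ forall t, A t \subset H m,
        forall t, #|A t| = \prod_(i in s t | i <= m) #|H i : H i.-1|%g,
        (\prod_(t < k) A t)%g = H m
      & forall t, (forall i, i \in s t -> m < i) -> A t = 1%g].
  have [A [sA cardA prodA _]] := chain n (leqnn n).
  exists A; split=> [t|t|]; rewrite -?Hn // cardA -s_index.
  by apply: eq_bigl => i; rewrite -ltnS ltn_ord andbT.
elim: m => [_|m IHm lt_mn].
  exists (fun=> 1%g); split=> // [t|t|]; rewrite ?sub1G ?H0 ?big1_eq //.
  rewrite cards1 big_pred0 // => i; apply/andP=> -[/s_pos].
  by rewrite leqn0; case: eqP => // ->.
have [A [sA cardA prodA trivA]] := IHm (ltnW lt_mn).
have sHm : H m \subset H m.+1 := proper_sub (Hlt m lt_mn).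
have ltj : m.+1 < n.+1 by [].
pose j := Ordinal ltj.
have /bigcupP[t _ jst] : j \in \bigcup_(t < k) s t by rewrite s_cover inE /= lt_mn.
(* This turns condition (i) at [j], whose value is [m.+1], into triviality of the factors on one
   side of [A t]. *)
have trivE u : s u :&: upto j = set0 -> A u = 1%g.
  move=> su0; apply: trivA => i isu; rewrite ltnNge; apply/negP=> le_im.
  have : i \in s u :&: upto j by rewrite !inE isu (s_pos u) //= leqW.
  by rewrite su0 inE.
have [B [sB cardB prodB]] : exists B : {set gT},
    [/\ B \subset H m.+1, #|B| = #|A t| * #|H m.+1 : H m|%g
      & (\prod_(u < k) (if u == t then B else A u))%g = H m.+1].
  apply: extend_factorization => //.
  by case: (s_order j t jst) => triv; [left | right] => u /triv/trivE.
exists (fun u => if u == t then B else A u); split=> // u.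
- by case: ifP => // _; apply: subset_trans (sA u) sHm.
- case: eqP => [->|/eqP neq_ut].
    rewrite cardB cardA [RHS](bigD1 j) ?jst //= mulnC; congr (_ * _).
    apply: eq_bigl => i; rewrite -andbA; congr (_ && _).
    by rewrite -val_eqE /= andbC -ltn_neqAle ltnS.
  (* For [u != t], raising the bound to [m.+1] adds no index, since [j] already belongs to [s t]. *)
  rewrite cardA; apply: eq_bigl => i.
  case isu: (i \in s u) => //=; rewrite [RHS]leq_eqVlt ltnS.
  case: eqP => // eq_im; have : i \in s u :&: s t.
    by rewrite inE isu (_ : i = j) //; apply: val_inj.
  by rewrite s_disj // inE.
(* For [u = t] the premise fails at [j] itself, so [B] need not be trivial. *)
case: eqP => [-> /(_ j jst)|_ su]; first by rewrite /= ltnn.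
by apply: trivA => i /su; apply: ltnW.
Qed.
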